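(* Let $(x^*,z^* )$ be an optimal solution of the benchmark LP below and run algorithm ALG2 below. For each $f=(i,k)\in\mathcal{F}$ let $Z_f$ be the indicator that feature $k$ is covered for task $i$ at the end (i.e. some edge of $E_f$ is matched). Then, in the limit $T\to\infty$, $$\mathbb{E}[Z_f]\ge 0.580\cdot\min\Big(1,\sum_{e\in E_f}x^*_e\Big)\quad\text{for all } f\in\mathcal{F}.$$
   Context: Setting (ONline Capacitated Coverage Maximization): bipartite graph $G=(I,J,E)$ with offline tasks $I$ and online worker types $J$, features $\mathcal{K}$, $\chi_j\in\{0,1\}^{\mathcal{K}}$, weights $w_{ik}\in[0,1]$, positive integer capacities $b_i,b_j$, horizon $T$, rates $r_j>0$ with $\sum_j r_j=T$; in each of $T$ rounds one worker arrives independently, of type $j$ with probability $r_j/T$. Notation: $E_\ell$ = edges at node $\ell$; $\mathcal{F}=I\times\mathcal{K}$; $E_f=\{(i,j)\in E_i:\chi_{jk}=1\}$ for $f=(i,k)$, $w_f=w_{ik}$. Benchmark LP: $\max\sum_f w_fz_f$ s.t. $z_f\le\min(1,\sum_{e\in E_f}x_e)$; $\sum_{e\in E_i}x_e\le b_i$; $x_e\le r_j$ for $e\in E_j$; $\sum_{e\in E_j}x_e\le b_jr_j$; $0\le x_e,z_f\le1$. Dependent rounding (Gandhi et al.) takes a fractional vector $(z_e)\in[0,1]^{E'}$ on the edges of a bipartite graph and outputs a random $(Z_e)\in\{0,1\}^{E'}$ with (P1) $\mathbb{E}[Z_e]=z_e$; (P2) for each node $\ell$, $\sum_{e\in E_\ell}Z_e\in\{\lfloor\sum_{e\in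 E_\ell}z_e\rfloor,\lceil\sum_{e\in E_\ell}z_e\rceil\}$ almost surely; (P3) for each node $\ell$, $S\subseteq E_\ell$, $c\in\{0,1\}$: $\Pr[\bigwedge_{e\in S}Z_e=c]\le\prod_{e\in S}\Pr[Z_e=c]$. ALG2: in each round, when a worker of type $j$ arrives, apply dependent rounding independently to the vector $(x^*_e/r_j)_{e\in E_j}$ obtaining $(X^*_e)_{e\in E_j}$, and match each $e=(i,j)\in E_j$ with $X^*_e=1$ provided $e$ has not been matched before and task $i$ has not yet received $b_i$ matches. *)

(* Defs.v *)
From HB Require Import structures.
From mathcomp Require Import all_boot all_order all_algebra.
From mathcomp Require Import reals.
Set Implicit Arguments.
Unset Strict Implicit.
Unset Printing Implicit Defensive.
Import Order.TTheory GRing.Theory Num.Theory.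
Local Open Scope ring_scope.

Section FiniteProbability.
Variables (R : realType) (A : finType).

Definition is_pmf (p : A -> R) : Prop :=
  (forall a, 0 <= p a) /\ \sum_a p a = 1.

Definition pr (p : A -> R) (ev : pred A) : R := \sum_(a | ev a) p a.

Definition expect (p : A -> R) (X : A -> R) : R := \sum_a p a * X a.

End FiniteProbability.

Section DependentRounding.
Variables (R : realType) (I J : finType).

(* [E_l], for a node [l] of the bipartite graph with parts [I] and [J]. *)
Definition edges_at (E : {set I * J}) (l : I + J) : {set I * J} :=
  match l with
  | inl i => [set e in E | e.1 == i]
  | inr j => [set e in E | e.2 == j]
  end.

(* [D] is a possible output law of dependent rounding on the edge set [E] and
   the vector [(z e)_(e in E)].  The random 0/1 vector [(Z e)_(e in E)] is
   encoded by the random set [X] of the edges [e] with [Z e = 1]. *)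
Record dependent_rounding (E : {set I * J}) (z : I * J -> R)
    (D : {set I * J} -> R) : Prop := DependentRounding {
  dr_pmf : is_pmf D ;
  dr_support : pr D (fun X => X \subset E) = 1 ;
  dr_marginal : forall e, e \in E ->
    expect D (fun X => (e \in X)%:R) = z e ;
  dr_degree : forall l : I + J,
    let s := \sum_(e in edges_at E l) z e in
    pr D (fun X => let d : int := Posz #|X :&: edges_at E l| in
                   (d == Num.floor s) || (d == Num.ceil s)) = 1 ;
  dr_negcorr : forall (l : I + J) (S : {set I * J}) (c : bool),
    S \subset edges_at E l ->
    pr D (fun X => [forall e in S, (e \in X) == c])
      <= \prod_(e in S) pr D (fun X => (e \in X) == c)
}.

End DependentRounding.

Record onccm (R : realType) (I J K : finType) (T : nat) := Onccm {
  graph : {set I * J} ;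
  feature : J -> K -> bool ;
  weight : I -> K -> R ;
  task_cap : I -> nat ;
  worker_cap : J -> nat ;
  rate : J -> R ;
  weight_itv : forall i k, 0 <= weight i k <= 1 ;
  task_cap_gt0 : forall i, (0 < task_cap i)%N ;
  worker_cap_gt0 : forall j, (0 < worker_cap j)%N ;
  rate_gt0 : forall j, 0 < rate j ;
  rate_sum : \sum_j rate j = T%:R
}.

Section OnCCM.
Variables (R : realType) (I J K : finType) (T : nat).
Variable N : onccm R I J K T.

Definition task_edges (i : I) : {set I * J} := edges_at (graph N) (inl i).

Definition worker_edges (j : J) : {set I * J} := edges_at (graph N) (inr j).

Definition feature_edges (f : I * K) : {set I * J} :=
  [set e in task_edges f.1 | feature N e.2 f.2].

(* Only the values of [x] on the edges of the graph are relevant. *)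
Record lp_feasible (x : I * J -> R) (z : I * K -> R) : Prop := LpFeasible {
  lp_cover : forall f,
    z f <= Num.min 1 (\sum_(e in feature_edges f) x e) ;
  lp_task_cap : forall i,
    \sum_(e in task_edges i) x e <= (task_cap N i)%:R ;
  lp_rate : forall j e, e \in worker_edges j -> x e <= rate N j ;
  lp_worker_cap : forall j,
    \sum_(e in worker_edges j) x e <= (worker_cap N j)%:R * rate N j ;
  lp_x_itv : forall e, e \in graph N -> 0 <= x e <= 1 ;
  lp_z_itv : forall f, 0 <= z f <= 1
}.

Definition lp_value (z : I * K -> R) : R := \sum_f weight N f.1 f.2 * z f.

Definition lp_optimal (x : I * J -> R) (z : I * K -> R) : Prop :=
  lp_feasible x z /\
  forall x' z', lp_feasible x' z' -> lp_value z' <= lp_value z.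

(* What happens in one round: the type of the arriving worker, and the set of
   the edges [e] with rounded value [X e = 1]. *)
Definition round_outcome : finType := (J * {set I * J})%type.

(* [M] is the set of the edges matched so far.  All the edges of
   [worker_edges a.1] have distinct tasks, so they can be treated at once. *)
Definition alg2_round (M : {set I * J}) (a : round_outcome) : {set I * J} :=
  M :|: [set e in worker_edges a.1 |
          [&& e \in a.2, e \notin M &
              (#|M :&: task_edges e.1| < task_cap N e.1)%N]].

Definition alg2 (rounds : T.-tuple round_outcome) : {set I * J} :=
  foldl alg2_round set0 rounds.

(* [D j] is the law of the rounding of a worker of type [j]; the rounds are
   independent and identically distributed. *)
Definition alg2_law (D : J -> {set I * J} -> R)
    (rounds : T.-tuple round_outcome) : R :=
  \prod_(t < T) (rate N (tnth rounds t).1 / T%:R *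
                 D (tnth rounds t).1 (tnth rounds t).2).

Definition covered (f : I * K) (rounds : T.-tuple round_outcome) : bool :=
  [exists e in feature_edges f, e \in alg2 rounds].

End OnCCM.

(* Main.v *)
(* Fix [f = (i, k)], and let [y = min(1, sum of x over E_f)].  In each round an
   edge [e] of [E_i] is sampled with probability [x_e / T], and at most one such
   edge is.  If one of the first [b_i] sampled edges, repetitions included, lies
   in [E_f], then [f] is covered.  A potential function shows that the least
   favourable case is a total sampling rate of [b = min(b_i, T)] and that the
   probability of covering is concave in [y], so that it is at least
   [y (1 - P)], where [P] is the probability that the first [b] arrivals miss
   [E_f] when [E_f] has rate 1.  For [b >= 13], a second moment bound gives
   [P <= (1 + 1 / (2 sqrt b)) / e <= 0.42].  For [b <= 12], [P] is at most its
   Poisson limit by convexity, and the limit is computed; the largest value is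
   about 0.4198, at [b = 3]. *)
Require Import Defs.
From mathcomp Require Import all_boot all_order all_algebra.
From mathcomp Require Import boolp reals normedtype sequences derive realfun exp.
From mathcomp Require Import ring lra.
Set Implicit Arguments.
Unset Strict Implicit.
Unset Printing Implicit Defensive.
Import Order.TTheory GRing.Theory Num.Theory.
Import numFieldNormedType.Exports.
Local Open Scope ring_scope.

(** * Recursion and second moment bound for the miss probability *)

Section MissProbability.
Variables (R : realType) (b T : nat).

(* The probability that no edge of [E_f] is among the first [c] arrivals during
   [n] rounds, when an edge of the task arrives with probability [b / T] per
   round, and one of [E_f] with probability [1 / T]. *)
Fixpoint miss (n c : nat) : R :=
  match n, c with
  | n'.+1, c'.+1 =>
      (1 - b%:R / T%:R) * miss n' c + (b%:R - 1) / T%:R * miss n' c'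
  | _, _ => 1
  end.

Lemma miss0n c : miss 0 c = 1. Proof. by case: c. Qed.
Lemma missn0 n : miss n 0 = 1. Proof. by case: n. Qed.
Lemma missSS n c : miss n.+1 c.+1 =
  (1 - b%:R / T%:R) * miss n c.+1 + (b%:R - 1) / T%:R * miss n c.
Proof. by []. Qed.

Hypotheses (b_gt0 : (0 < b)%N) (b_le_T : (b <= T)%N).

Let T_gt0 : 0 < T%:R :> R.
Proof. by rewrite ltr0n (leq_trans b_gt0). Qed.

Let stay_ge0 : 0 <= 1 - b%:R / T%:R :> R.
Proof. by rewrite subr_ge0 ler_pdivrMr// mul1r ler_nat. Qed.

Let other_ge0 : 0 <= (b%:R - 1) / T%:R :> R.
Proof. by rewrite divr_ge0 ?subr_ge0 ?ler1n// ltW. Qed.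

Lemma miss_itv n c : 0 <= miss n c <= 1.
Proof.
elim: n c => [|n IHn] [|c]; rewrite ?miss0n ?missn0 ?ler01 ?lexx//.
rewrite missSS; have /andP[? ?] := IHn c.+1; have /andP[? ?] := IHn c.
have Tn : T%:R != 0 :> R by rewrite gt_eqF.
apply/andP; split; first by apply: addr_ge0; apply: mulr_ge0.
apply: (@le_trans _ _ ((1 - b%:R / T%:R) + (b%:R - 1) / T%:R)).
  by apply: lerD; rewrite ler_piMr.
have -> : (1 - b%:R / T%:R) + (b%:R - 1) / T%:R = 1 - T%:R^-1 :> R by field.
by rewrite gerBl invr_ge0 ltW.
Qed.

Lemma miss_nonincr n c : miss n c.+1 <= miss n c.
Proof.
elim: n c => [|n IHn] [|c]; rewrite ?miss0n ?missn0//.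
  by have /andP[] := miss_itv n.+1 1.
by rewrite !missSS lerD// ler_wpM2l.
Qed.

Lemma miss_antitone n c c' : (c <= c')%N -> miss n c' <= miss n c.
Proof.
move=> /subnKC <-; elim: (c' - c)%N => [|d IHd]; first by rewrite addn0.
by rewrite addnS (le_trans (miss_nonincr _ _)).
Qed.

(* With [q = 1 - 1/b] and [N] the number of arrivals, [miss] is the expectation
   of [q^min(N, c)].  This is at most [q^N + q^c (N - c)^+ / b], where the
   positive part [X^+] is at most [(X + (X^2 / s + s) / 2) / 2].  The
   expectation of this bound over a binomial [N] satisfies the recursion of
   [miss] exactly. *)
Lemma miss_le_variance (s : R) n c : 0 < s ->
  miss n c <= (1 - T%:R^-1) ^+ n + (1 - b%:R^-1) ^+ c / b%:R *
    let p := b%:R / T%:R in let d := n%:R * p - c%:R in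
    (d + ((n%:R * p * (1 - p) + d ^+ 2) / s + s) / 2) / 2.
Proof.
move=> s_gt0.
have b0 : b%:R != 0 :> R by rewrite pnatr_eq0 -lt0n.
have bR : 0 < b%:R :> R by rewrite ltr0n.
have T0 : T%:R != 0 :> R by rewrite gt_eqF.
have s0 : s != 0 by rewrite gt_eqF.
have q_ge0 : 0 <= 1 - b%:R^-1 :> R by rewrite subr_ge0 invf_le1// ler1n.
have quad (d : R) : 0 <= d + (d ^+ 2 / s + s) / 2.
  have -> : d + (d ^+ 2 / s + s) / 2 = (d + s) ^+ 2 / s / 2 by field.
  by rewrite !divr_ge0 ?sqr_ge0 ?ltW.
have quad' (d : R) : d <= (d ^+ 2 / s + s) / 2.
  by have := quad (- d); rewrite sqrrN addrC subr_ge0.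
elim: n c => [|n IHn] c.
  by rewrite miss0n expr0 /= !mul0r !add0r lerDl mulr_ge0 ?divr_ge0 ?exprn_ge0// ?ltW//.
case: c => [|c].
  rewrite missn0 expr0 div1r /= subr0.
  set p := b%:R / T%:R; set m : R := n.+1%:R.
  have mp_ge0 : 0 <= m * p by rewrite mulr_ge0// divr_ge0.
  have p_le1 : 0 <= 1 - p by exact: stay_ge0.
  (* Bernoulli's inequality. Its loss [m / T] equals [m p / b], which the second term of the bound
     makes up for by [quad']. *)
  have bern : 1 - m / T%:R <= (1 - T%:R^-1) ^+ n.+1.
    have T1 : 0 <= 1 - T%:R^-1 :> R.
      by rewrite subr_ge0 invf_le1// ler1n (leq_trans b_gt0).
    rewrite /m; elim: n.+1 => [|k IHk]; first by rewrite expr0 mul0r subr0.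
    rewrite exprSr; apply: le_trans (ler_wpM2r T1 IHk).
    rewrite -natr1; set iT := T%:R^-1.
    have : 0 <= k%:R * iT ^+ 2 by rewrite mulr_ge0 ?sqr_ge0.
    by nra.
  have e : 1 - m / T%:R + b%:R^-1 * (m * p) = 1 by rewrite /p; field; rewrite T0.
  rewrite -[leLHS]e; apply: lerD => //; apply: ler_wpM2l; first by rewrite invr_ge0.
  apply: (@le_trans _ _ ((m * p + ((m * p) ^+ 2 / s + s) / 2) / 2)).
    by have := quad' (m * p); lra.
  have : 0 <= m * p * (1 - p) / s.
    by rewrite divr_ge0 ?(ltW s_gt0)// (mulr_ge0 mp_ge0).
  by rewrite (mulrDl _ _ s^-1); lra.
rewrite missSS.
apply: le_trans (lerD (ler_wpM2l stay_ge0 (IHn _)) (ler_wpM2l other_ge0 (IHn _))) _.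
rewrite le_eqVlt; apply/orP; left; apply/eqP => /=.
rewrite !exprS -[n.+1%:R]natr1 -[c.+1%:R]natr1.
by field; rewrite s0 T0 b0.
Qed.

End MissProbability.

(** * Truncated exponential series *)

Section ExpPartialSum.
Variable R : realType.

Definition expS (c : nat) : {poly R} := \poly_(k < c) (k`!%:R)^-1.

Lemma horner_expS c u : (expS c).[u] = \sum_(k < c) u ^+ k / k`!%:R.
Proof. by rewrite horner_poly; apply: eq_bigr => k _; rewrite mulrC. Qed.

Lemma horner_expSS c u : (expS c.+1).[u] = (expS c).[u] + u ^+ c / c`!%:R.
Proof. by rewrite !horner_expS big_ord_recr. Qed.

Lemma horner_expS0 c : (expS c.+1).[0] = 1.
Proof.
rewrite horner_expS big_ord_recl big1 ?addr0 ?expr0 ?divr1// => i _.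
by rewrite expr0n mul0r.
Qed.

Lemma horner_expS_ge0 c u : 0 <= u -> 0 <= (expS c).[u].
Proof.
by move=> u0; rewrite horner_expS sumr_ge0// => k _; rewrite divr_ge0 ?exprn_ge0.
Qed.

Lemma deriv_expS c : (expS c.+1)^`() = expS c.
Proof.
apply/polyP => k; rewrite coef_deriv !coef_poly ltnS; case: ifP => _; last by rewrite mul0rn.
by rewrite -[LHS]mulr_natr factS natrM invfM mulrAC mulVf ?mul1r// pnatr_eq0.
Qed.

(** For [b > 0], this is the expectation of [(a/b)^N] on the event [N < c], where [N] is Poisson of
    mean [b t]. *)
Definition damped (a b : R) (c : nat) (t : R) : R :=
  expR (- b * t) * (expS c).[a * t].

Lemma is_derive_damped (a b : R) c (t : R) :
  is_derive t 1 (damped a b c.+1) (a * damped a b c t - b * damped a b c.+1 t).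
Proof.
have dlin (k : R) : is_derive t 1 ( *%R k) k.
  have -> : *%R k = horner (k *: 'X) by apply/funext => v; rewrite hornerZ hornerX.
  by apply: is_derive_eq; rewrite derivZ derivX hornerZ hornerC mulr1.
have d := is_deriveM (is_derive1_comp (is_derive_expR (- b * t)) (dlin (- b)))
  (is_derive1_comp (is_derive_poly (expS c.+1) (a * t)) (dlin a)).
apply: (is_derive_eq d); rewrite deriv_expS /damped /GRing.scale /=.
by ring.
Qed.

Lemma mean_value (f df : R -> R) (x y : R) : x <= y ->
  (forall t : R, is_derive t 1 f (df t)) ->
  exists2 t, x <= t <= y & f y - f x = df t * (y - x).
Proof.
move=> xy fdf; have [|t] := MVT_segment xy (fun t _ => fdf t).
  by apply: derivable_within_continuous => t _; have [] := fdf t.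
by rewrite in_itv; exists t.
Qed.

(** The derivative is nonpositive: raising [c] adds a nonnegative term to the series, and
    [a <= b]. *)
Lemma damped_nonincr (a b : R) c (s t : R) : 0 <= a <= b -> 0 <= s <= t ->
  damped a b c t <= damped a b c s.
Proof.
move=> /andP[a0 ab] /andP[s0 st].
case: c => [|c]; first by rewrite /damped !horner_expS !big_ord0 !mulr0.
have [v /andP[sv _] e] := mean_value st (is_derive_damped a b c).
rewrite -subr_le0 e mulr_le0_ge0 ?subr_ge0// subr_le0.
have v0 := le_trans s0 sv.
rewrite /damped horner_expSS.
apply: ler_pM => //; first by rewrite mulr_ge0 ?expR_ge0 ?horner_expS_ge0 ?mulr_ge0.
by rewrite ler_wpM2l ?expR_ge0// lerDl divr_ge0 ?exprn_ge0 ?mulr_ge0.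
Qed.

End ExpPartialSum.

(** * Comparison with the Poisson limit *)

Section PoissonBound.
Variables (R : realType) (b T : nat).
Hypotheses (b_gt0 : (0 < b)%N) (b_le_T : (b <= T)%N).

(* The expectation of [(1 - 1/b)^min(N, c)] for [N] Poisson of mean [b t]. *)
Definition poisson_miss (c : nat) (t : R) : R :=
  damped (b%:R - 1) b%:R c t + (1 - b%:R^-1) ^+ c * (1 - damped b%:R b%:R c t).

Lemma poisson_miss0 t : poisson_miss 0 t = 1.
Proof. by rewrite /poisson_miss /damped !horner_expS !big_ord0 !mulr0 expr0; ring. Qed.

Lemma poisson_miss_at0 c : poisson_miss c.+1 0 = 1.
Proof. by rewrite /poisson_miss /damped !mulr0 expR0 !horner_expS0; ring. Qed.

(** The constants cancel because [b q^(c+1) = (b - 1) q^c] with [q = 1 - 1/b], and so do the series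
    terms of index [c]. With the derivative below, this gives the differential equation
    [P_(c+1)' = (b - 1) P_c - b P_(c+1)]. *)
Lemma poisson_miss_rec c t :
  b%:R * poisson_miss c.+1 t - (b%:R - 1) * poisson_miss c t =
  damped (b%:R - 1) b%:R c.+1 t.
Proof.
have b0 : b%:R != 0 :> R by rewrite pnatr_eq0 -lt0n.
have q : b%:R - 1 = (1 - b%:R^-1) * b%:R :> R by field.
rewrite /poisson_miss /damped !horner_expSS q !exprMn exprS.
have c0 : c`!%:R != 0 :> R by rewrite pnatr_eq0 -lt0n fact_gt0.
by field; rewrite ?b0 ?c0.
Qed.

Lemma is_derive_poisson_miss c (t : R) :
  is_derive t 1 (poisson_miss c.+1) (- damped (b%:R - 1) b%:R c.+1 t).
Proof.
have b0 : b%:R != 0 :> R by rewrite pnatr_eq0 -lt0n.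
have d := is_deriveD (is_derive_damped (b%:R - 1) b%:R c t)
  (is_deriveZ ((1 - b%:R^-1) ^+ c.+1)
    (is_deriveB (is_derive_cst (1 : R) t 1) (is_derive_damped b%:R b%:R c t))).
apply: (is_derive_eq d); rewrite -poisson_miss_rec /poisson_miss /GRing.scale /=.
rewrite /damped !horner_expSS.
have q : b%:R - 1 = (1 - b%:R^-1) * b%:R :> R by field.
have c0 : c`!%:R != 0 :> R by rewrite pnatr_eq0 -lt0n fact_gt0.
rewrite q !exprMn exprS.
by field; rewrite ?b0 ?c0.
Qed.

(* [poisson_miss c] is convex in [t], so an Euler step of the differential
   equation it solves stays below it; these Euler steps are [miss]. *)
Lemma miss_le_poisson n c : miss R b T n c <= poisson_miss c (n%:R / T%:R).
Proof.
have T_gt0 : 0 < T%:R :> R by rewrite ltr0n (leq_trans b_gt0).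
have b1 : 0 <= b%:R - 1 :> R by rewrite subr_ge0 ler1n.
have bb : 0 <= (b%:R - 1 : R) <= b%:R by rewrite b1 gerBl ler01.
elim: n c => [|n IHn] [|c]; rewrite ?miss0n ?missn0 ?poisson_miss0//.
  by rewrite mul0r poisson_miss_at0.
rewrite missSS; set t : R := n%:R / T%:R; set h : R := T%:R^-1.
have h0 : 0 <= h by rewrite invr_ge0 ltW.
have t0 : 0 <= t by rewrite divr_ge0// ltW.
have -> : n.+1%:R / T%:R = t + h by rewrite -natr1 mulrDl mul1r.
(* The middle term is the tangent at [t], evaluated at [t + h]. *)
apply: (@le_trans _ _ (poisson_miss c.+1 t - h * damped (b%:R - 1) b%:R c.+1 t)).
  rewrite -poisson_miss_rec.
  have stay : 0 <= 1 - b%:R / T%:R :> R by rewrite subr_ge0 ler_pdivrMr// mul1r ler_nat.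
  have other : 0 <= (b%:R - 1) / T%:R :> R by rewrite divr_ge0// ltW.
  apply: le_trans (lerD (ler_wpM2l stay (IHn _)) (ler_wpM2l other (IHn _))) _.
  by rewrite le_eqVlt; apply/orP; left; apply/eqP; rewrite /t /h; ring.
have th : t <= t + h by rewrite lerDl.
have [v /andP[tv _] e] := mean_value th (is_derive_poisson_miss c).
have -> : poisson_miss c.+1 (t + h) =
    poisson_miss c.+1 t + - damped (b%:R - 1) b%:R c.+1 v * h.
  by move: e; rewrite (_ : t + h - t = h); [lra | ring].
rewrite lerD2l mulNr lerN2 [leLHS]mulrC ler_wpM2l//.
by apply: damped_nonincr; rewrite ?t0.
Qed.

End PoissonBound.

(** * The numerical bound 0.42 *)

Section Numerics.
Variable R : realType.

(** For [c > 0], [damped 1 1 c] is 1 at 0 and does not increase. *)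
Lemma horner_expS_le_expR c (u : R) : 0 <= u -> (expS R c).[u] <= expR u.
Proof.
move=> u0; have b1 : 0 <= (1 : R) <= 1 by rewrite ler01 lexx.
case: c => [|c]; first by rewrite horner_expS big_ord0 expR_ge0.
have := @damped_nonincr R 1 1 c.+1 0 u b1.
rewrite /damped !mul1r !mulN1r oppr0 expR0 horner_expS0 mulr1 lexx u0 => /(_ isT).
by rewrite expRN mulrC ler_pdivrMr ?expR_gt0// mul1r.
Qed.

Lemma expRN1_le : expR (-1) <= 1000 / 2718 :> R.
Proof.
rewrite expRN -invf_div lef_pV2 ?posrE ?expR_gt0 ?divr_gt0//.
(* Seven terms of the series of [e] sum to 1957/720, just above 2.718. *)
apply: le_trans (horner_expS_le_expR 7 ler01).
rewrite horner_expS !big_ord_recr big_ord0 /= !expr1n !factS fact0.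
by lra.
Qed.

Lemma miss_le_small (b T : nat) : (0 < b <= 12)%N -> (b <= T)%N ->
  miss R b T T b <= 42 / 100.
Proof.
move=> /andP[b_gt0 b12] bT.
apply: le_trans (miss_le_poisson R b_gt0 bT T b) _.
have b0 : b%:R != 0 :> R by rewrite pnatr_eq0 -lt0n.
rewrite divff; last by rewrite pnatr_eq0 -lt0n (leq_trans b_gt0).
rewrite /poisson_miss /damped !mulr1.
have -> : expR (- b%:R) = expR (-1) ^+ b :> R by rewrite -expRM_natl mulrN1.
set E := expR (-1) : R.
have E0 : 0 <= E by exact: expR_ge0.
have Eb : E ^+ b <= (1000 / 2718) ^+ b 
  by apply: lerXn2r; rewrite ?nnegrE ?divr_ge0//; exact: expRN1_le.
set p := (expS R b).[_ - 1]; set q := (1 - _) ^+ b; set r := (expS R b).[_].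
(* The bound [E^b (p - q r) + q] is nondecreasing in [E^b] once [p >= q r], so a rational upper
   bound on [E] reduces each [b] to rational arithmetic. *)
have key : 0 <= p - q * r /\ (1000 / 2718) ^+ b * (p - q * r) + q <= 42 / 100.
  rewrite {}/p {}/q {}/r !horner_expS {Eb b0 bT}.
  case: b b_gt0 b12 => [//|b] _.
  do 12 (case: b => [_|b];
    first by rewrite !big_ord_recr !big_ord0 /= ?factS fact0; split; lra).
  by [].
have [k1 k2] := key.
apply: le_trans k2.
have := ler_wpM2r k1 Eb; lra.
Qed.

Lemma exprn_subVn_le (n : nat) : (0 < n)%N ->
  (1 - n%:R^-1) ^+ n <= 1000 / 2718 :> R.
Proof.
move=> n0; apply: le_trans expRN1_le.
have nR : 0 < n%:R :> R by rewrite ltr0n.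
have -> : expR (-1) = expR (- n%:R^-1) ^+ n :> R.
  by rewrite -expRM_natl mulrN divff// gt_eqF.
apply: lerXn2r; rewrite ?nnegrE ?expR_ge0//; last exact: expR_ge1Dx.
by rewrite subr_ge0 invf_le1// ler1n.
Qed.

Lemma miss_le_large (b T : nat) : (13 <= b)%N -> (b <= T)%N ->
  miss R b T T b <= 42 / 100.
Proof.
move=> b13 bT.
have b_gt0 : (0 < b)%N by apply: leq_trans b13.
have bR : 0 < b%:R :> R by rewrite ltr0n.
have T0 : 0 < T%:R :> R by rewrite ltr0n (leq_trans b_gt0).
have b13R : 13 <= b%:R :> R by rewrite ler_nat.
(* The number of arrivals has mean [b] and variance at most [b]; this [s] minimizes [b / s + s]. *)
set s := Num.sqrt b%:R : R.
have s2 : s ^+ 2 = b%:R by rewrite sqr_sqrtr// ltW.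
(* [3.6^2 = 12.96 <= 13], and [(1 + 1/7.2) / 2.718 < 0.4191]. *)
have s_ge : 36 / 10 <= s.
  rewrite -(@ler_pXn2r _ 2)// ?nnegrE ?sqrtr_ge0 ?divr_ge0// s2.
  by apply: le_trans b13R; lra.
have s0 : 0 < s by apply: lt_le_trans s_ge; lra.
apply: le_trans (miss_le_variance b_gt0 bT T b s0) _.
have pT : T%:R * (b%:R / T%:R) = b%:R :> R by field; rewrite gt_eqF.
rewrite /= pT subrr expr0n /= addr0 add0r.
have eT := exprn_subVn_le (leq_trans b_gt0 bT).
have eb := exprn_subVn_le b_gt0.
set q := (1 - b%:R^-1) ^+ b in eb *.
have q0 : 0 <= q by rewrite exprn_ge0// subr_ge0 invf_le1// ler1n.
have half : ((b%:R * (1 - b%:R / T%:R)) / s + s) / 2 / 2 <= s / 2.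
  have : b%:R * (1 - b%:R / T%:R) / s <= s.
    rewrite ler_pdivrMr// -expr2 s2 ler_piMr ?(ltW bR)// gerBl divr_ge0 ?ltW//.
  by lra.
apply: (@le_trans _ _ (1000 / 2718 + q / b%:R * (s / 2))).
  by apply: lerD => //; apply: ler_wpM2l => //; rewrite divr_ge0// ltW.
have -> : q / b%:R * (s / 2) = q * (2 * s)^-1.
  by rewrite -s2; field; rewrite gt_eqF.
have : (2 * s)^-1 <= (72 / 10)^-1.
  by rewrite lef_pV2 ?posrE; lra.
have : 0 <= (2 * s)^-1 by rewrite invr_ge0 mulr_ge0// ltW.
by nra.
Qed.

Lemma miss_le (b T : nat) : (0 < b)%N -> (b <= T)%N -> miss R b T T b <= 42 / 100.
Proof.
move=> b0 bT; case: (leqP b 12) => b12; last exact: miss_le_large.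
by apply: miss_le_small; rewrite ?b0.
Qed.

End Numerics.

(** * Potential functions for independent rounds *)

Section IteratedPotential.
Variables (R : realType) (A : finType) (S : Type).
Variables (w : A -> R) (step : S -> A -> S) (phi : S -> R) (Psi : nat -> S -> R).
Hypothesis w_ge0 : forall a, 0 <= w a.
Hypothesis phi_ge : forall s, Psi 0 s <= phi s.
Hypothesis step_ge : forall n s, Psi n.+1 s <= \sum_a w a * Psi n (step s a).

Lemma sum_tuple_cons n (F : n.+1.-tuple A -> R) :
  \sum_t F t = \sum_a \sum_(t : n.-tuple A) F [tuple of a :: t].
Proof.
rewrite pair_big /=.
rewrite (reindex (fun p : A * n.-tuple A => [tuple of p.1 :: p.2])) //=.
exists (fun t => (thead t, [tuple of behead t])) => [[a t] _|t _] /=.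
  by rewrite theadE; congr pair; apply: val_inj.
by rewrite -tuple_eta.
Qed.

(** A submartingale argument: [Psi n] is what is guaranteed with [n] rounds left. The induction
    splits off the first round, which [foldl] processes first. *)
Lemma potential_le_sum_foldl n s :
  Psi n s <=
  \sum_(t : n.-tuple A) (\prod_(i < n) w (tnth t i)) * phi (foldl step s t).
Proof.
elim: n s => [|n IHn] s.
  rewrite (eq_bigr (fun=> phi s)) => [|t _]; last by rewrite big_ord0 mul1r (tuple0 t).
  by rewrite sumr_const card_tuple expn0 mulr1n phi_ge.
apply: (le_trans (step_ge n s)); rewrite sum_tuple_cons; apply: ler_sum => a _.
apply: (le_trans (ler_wpM2l (w_ge0 a) (IHn (step s a)))).
rewrite mulr_sumr le_eqVlt; apply/orP; left; apply/eqP.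
apply: eq_bigr => t _; rewrite big_ord_recl /= -mulrA tnth0; congr (_ * (_ * _)).
by apply: eq_bigr => i _; rewrite tnthS.
Qed.

End IteratedPotential.

(** * Coverage of a feature by ALG2 *)

Section Coverage.
Variables (R : realType) (I J K : finType) (T : nat) (N : onccm R I J K T).
Variables (x : I * J -> R) (z : I * K -> R) (D : J -> {set I * J} -> R).
Hypothesis T_gt0 : (0 < T)%N.
Hypothesis feas : lp_feasible N x z.
Hypothesis rounding : forall j : J,
  dependent_rounding (worker_edges N j) (fun e => x e / rate N j) (D j).

Let T0 : 0 < T%:R :> R. Proof. by rewrite ltr0n. Qed.

Let w (a : round_outcome I J) : R := rate N a.1 / T%:R * D a.1 a.2.

Let w_ge0 a : 0 <= w a.
Proof.
have [[D0 _] _ _ _ _] := rounding a.1.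
by rewrite mulr_ge0// divr_ge0 ?ltW ?rate_gt0.
Qed.

Let sum_w : \sum_a w a = 1.
Proof.
rewrite -(pair_bigA _ (fun j X => rate N j / T%:R * D j X)) /=.
rewrite (eq_bigr (fun j => rate N j / T%:R)) => [|j _].
  by rewrite -mulr_suml rate_sum divff// gt_eqF.
by have [[_ D1] _ _ _ _] := rounding j; rewrite -mulr_sumr D1 mulr1.
Qed.

Lemma task_edgesE i e : (e \in task_edges N i) = (e \in graph N) && (e.1 == i).
Proof. by rewrite inE. Qed.

Lemma worker_edgesE j e : (e \in worker_edges N j) = (e \in graph N) && (e.2 == j).
Proof. by rewrite inE. Qed.

Lemma sum_task_edges i (F : {set I * J}) (g : I * J -> R) :
  F \subset task_edges N i ->
  \sum_(e in F) g e = \sum_(j | (i, j) \in F) g (i, j).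
Proof.
move=> /subsetP FE; rewrite (reindex_onto (fun j => (i, j)) snd) /=.
  by apply: eq_bigl => j; rewrite eqxx andbT.
by move=> e /FE; rewrite task_edgesE => /andP[_ /eqP <-]; rewrite -surjective_pairing.
Qed.

(** An arrival of type [j] can sample only the edge [(i, j)] at task [i], so the events are
    disjoint, and [(r_j / T) (x_e / r_j) = x_e / T]. *)
Lemma expect_sampled i (F : {set I * J}) : F \subset task_edges N i ->
  \sum_a w a * (((i, a.1) \in F) && ((i, a.1) \in a.2))%:R =
  (\sum_(e in F) x e) / T%:R.
Proof.
move=> FE; rewrite (sum_task_edges _ FE) mulr_suml [RHS]big_mkcond /=.
rewrite -(pair_bigA _ (fun j X =>
  rate N j / T%:R * D j X * (((i, j) \in F) && ((i, j) \in X))%:R)) /=.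
apply: eq_bigr => j _; case: ifP => [ijF|_]; last first.
  by rewrite big1// => X _; rewrite mulr0.
have [_ _ marg _ _] := rounding j.
have ijE : (i, j) \in worker_edges N j.
  by have := subsetP FE _ ijF; rewrite task_edgesE worker_edgesE !eqxx.
have := marg _ ijE; rewrite /expect => m.
rewrite (eq_bigr (fun X => rate N j / T%:R * (D j X * ((i, j) \in X)%:R))) => [|X _].
  by rewrite -mulr_sumr m; field; rewrite !gt_eqF ?rate_gt0.
by rewrite mulrA.
Qed.

Section Feature.
Variable f : I * K.
Let i := f.1.
Let E_i := task_edges N i.
Let F := feature_edges N f.
Let b := minn (task_cap N i) T.
Let y : R := Num.min 1 (\sum_(e in F) x e).

Let FE : F \subset E_i.
Proof. by apply/subsetP => e; rewrite inE => /andP[]. Qed.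

Let x_ge0 e : e \in E_i -> 0 <= x e.
Proof.
rewrite task_edgesE => /andP[eG _].
by have /andP[] := lp_x_itv feas eG.
Qed.

Let b_gt0 : (0 < b)%N. Proof. by rewrite leq_min task_cap_gt0. Qed.
Let b_le_T : (b <= T)%N. Proof. exact: geq_minr. Qed.

Let y_itv : 0 <= y <= 1.
Proof.
rewrite ge_min lexx andbT le_min ler01 sumr_ge0// => e eF.
by rewrite x_ge0// (subsetP FE).
Qed.

(** The bound by [T] holds because task [i] has at most one edge per worker type, with [x_e <= r_j],
    and the rates sum to [T]. *)
Let sum_x_le : \sum_(e in E_i) x e <= b%:R.
Proof.
rewrite /b natr_min le_min (lp_task_cap feas) /= -(rate_sum N).
rewrite (sum_task_edges _ (subxx _)) big_mkcond /=; apply: ler_sum => j _.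
case: ifP => [ijE|_]; last by rewrite ltW// rate_gt0.
apply: (lp_rate feas).
by move: ijE; rewrite task_edgesE worker_edgesE !eqxx.
Qed.

Definition hits (M : {set I * J}) : bool := [exists e in F, e \in M].

(* The tasks' capacity is cut down to [T], which changes nothing over [T] rounds. *)
Let room (M : {set I * J}) : nat := (b - #|M :&: E_i|)%N.

(** The guarantee with [n] rounds and [c] slots left. Scaling the rate 1 probability by [y] replaces
    the concave dependence on [y] by its chord. *)
Let gain n c : R := y * (1 - miss R b T n c).

Definition potential n (M : {set I * J}) : R := if hits M then 1 else gain n (room M).

Let gain_itv n c : 0 <= gain n c <= 1.
Proof.
have /andP[m0 m1] := miss_itv R b_gt0 b_le_T n c.
have /andP[y0 y1] := y_itv.
rewrite mulr_ge0 ?subr_ge0//=.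
by rewrite mulr_ile1 ?subr_ge0// gerBl.
Qed.

Let gain_homo n c c' : (c <= c')%N -> gain n c <= gain n c'.
Proof.
move=> cc'; have /andP[y0 _] := y_itv.
by rewrite ler_wpM2l// lerD2l lerN2 (miss_antitone R b_gt0 b_le_T).
Qed.

Let potential_ge0 n M : 0 <= potential n M.
Proof. by rewrite /potential; case: ifP => // _; have /andP[] := gain_itv n (room M). Qed.

(** All edges added in a round share the arriving worker type, so at most one of them is at task
    [i]. *)
Lemma alg2_round_task M (a : round_outcome I J) :
  alg2_round N M a :&: E_i \subset
    if ((i, a.1) \in E_i) && ((i, a.1) \in a.2) then (i, a.1) |: (M :&: E_i)
    else M :&: E_i.
Proof.
set e := (i, a.1); apply/subsetP => e'; rewrite !in_setI => /andP[+ e'E].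
rewrite inE => /orP[e'M|].
  by case: ifP => _; rewrite !inE e'M ?orbT //=; move: e'E; rewrite !inE => ->; rewrite ?orbT.
rewrite inE => /and4P[+ e'X e'M _]; rewrite worker_edgesE => /andP[_ /eqP e'j].
have -> : e = e'.
  move: e'E; rewrite task_edgesE => /andP[_ /eqP e'i].
  by rewrite /e -e'i -e'j -surjective_pairing.
by rewrite e'E e'X setU11.
Qed.

(** A sampled edge of the task is charged a slot even if it was matched before; one in [F] raises
    the potential to 1. The bound is linear in the two indicators, so that its expectation follows
    from [expect_sampled]. *)
Lemma potential_round n M (a : round_outcome I J) : ~~ hits M -> (0 < room M)%N ->
  gain n (room M)
    - (((i, a.1) \in E_i) && ((i, a.1) \in a.2))%:R *
      (gain n (room M) - gain n (room M).-1)
    + (((i, a.1) \in F) && ((i, a.1) \in a.2))%:R * (1 - gain n (room M).-1)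
  <= potential n (alg2_round N M a).
Proof.
move=> nM roomM; set e := (i, a.1); set k := (room M).-1.
have kE : room M = k.+1 by rewrite prednK.
rewrite kE.
case: (boolP ((e \in F) && (e \in a.2))) => [/andP[eF eX]|neF].
  have eE := subsetP FE _ eF.
  have hit : hits (alg2_round N M a).
    apply/existsP; exists e; rewrite eF /=.
    move: (eE); rewrite task_edgesE => /andP[eG _].
    rewrite inE; apply/orP; right; rewrite inE worker_edgesE eG eqxx eX /=.
    (* [M] contains no edge of [F], and room under the capacity cut down to [T] is room under the
       true one. *)
    apply/andP; split.
      by apply: contra nM => eM; apply/existsP; exists e; rewrite eF.
    move: roomM; rewrite /room subn_gt0 => h; apply: leq_trans h _.
    exact: geq_minl.
  by rewrite /potential hit eE eX /= !mul1r; lra.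
rewrite mul0r addr0.
apply: (@le_trans _ _ (gain n (room (alg2_round N M a)))); last first.
  by rewrite /potential; case: ifP => // _; have /andP[] := gain_itv n (room (alg2_round N M a)).
have := subset_leq_card (alg2_round_task M a); rewrite /= -/e.
case: ifP => _ le_card.
  rewrite mul1r opprB addrC subrK; apply: gain_homo.
  move: le_card; rewrite cardsU1 => le_card.
  have : (#|alg2_round N M a :&: E_i| <= #|M :&: E_i|.+1)%N.
    by apply: leq_trans le_card _; case: (_ \notin _); rewrite ?add1n ?add0n.
  by move=> h; rewrite /k /room -subnS leq_sub2l.
by rewrite mul0r subr0 -kE; apply: gain_homo; rewrite leq_sub2l.
Qed.

Lemma potential_step n M :
  potential n.+1 M <= \sum_a w a * potential n (alg2_round N M a).
Proof.
have /andP[y0 y1] := y_itv.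
case: (boolP (hits M)) => [hM|nM].
  rewrite /potential hM -[leLHS]sum_w; apply: ler_sum => a _.
  have [e /andP[eF eM]] := existsP hM.
  have hit : hits (alg2_round N M a).
    by apply/existsP; exists e; rewrite eF in_setU eM.
  by rewrite hit mulr1.
rewrite {1}/potential (negPf nM).
case: (posnP (room M)) => [->|roomM].
  rewrite /gain missn0 subrr mulr0 sumr_ge0// => a _.
  by rewrite mulr_ge0// potential_ge0.
have step a := ler_wpM2l (w_ge0 a) (potential_round n a nM roomM).
apply: le_trans (ler_sum _ (fun a _ => step a)) => /=.
set k := (room M).-1; have kE : room M = k.+1 by rewrite prednK.
rewrite kE.
rewrite (eq_bigr (fun a => w a * gain n k.+1
  - (w a * (((i, a.1) \in E_i) && ((i, a.1) \in a.2))%:R) * (gain n k.+1 - gain n k)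
  + (w a * (((i, a.1) \in F) && ((i, a.1) \in a.2))%:R) * (1 - gain n k))); last first.
  by move=> a _; ring.
rewrite big_split sumrB /= -!mulr_suml sum_w.
rewrite (expect_sampled (subxx _)) (expect_sampled FE).
have y_le : y <= \sum_(e in F) x e by rewrite /y ge_min lexx orbT.
have s_le := sum_x_le.
have /andP[_ g1] := gain_itv n k.
have g01 := gain_homo n (leqnSn k).
have /andP[m0 m1] := miss_itv R b_gt0 b_le_T n k.
(* The least favourable rates: [b] for the task, as [gain] grows with the slots, and [y] for [F], as
   [gain] is at most 1. *)
apply: (@le_trans _ _ (1 * gain n k.+1 - b%:R / T%:R * (gain n k.+1 - gain n k)
  + y / T%:R * (1 - gain n k))).
  (* The slack, of order [y (1 - y)], reflects the concavity in [y]. *)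
  have -> : 1 * gain n k.+1 - b%:R / T%:R * (gain n k.+1 - gain n k)
      + y / T%:R * (1 - gain n k) =
      gain n.+1 k.+1 + y * (1 - y) * (1 - miss R b T n k) / T%:R.
    by rewrite /gain missSS; ring.
  by rewrite lerDl; apply: divr_ge0; [rewrite !mulr_ge0 ?subr_ge0|exact: ltW].
apply: lerD.
  rewrite lerD2l lerN2; apply: ler_wpM2r; first by rewrite subr_ge0.
  by apply: ler_wpM2r => //; rewrite invr_ge0 ltW.
apply: ler_wpM2r; first by rewrite subr_ge0.
by apply: ler_wpM2r => //; rewrite invr_ge0 ltW.
Qed.

Lemma covered_ge :
  58 / 100 * y <= expect (alg2_law N D) (fun rounds => (covered N f rounds)%:R).
Proof.
have /andP[y0 _] := y_itv.
have phi_ge M : potential 0 M <= (hits M)%:R.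
  by rewrite /potential; case: (hits M) => //=; rewrite /gain miss0n subrr mulr0.
have := potential_le_sum_foldl w_ge0 phi_ge potential_step T set0.
apply: le_trans; rewrite /potential ifF; last first.
  by apply/negbTE/existsP => -[e]; rewrite in_set0 andbF.
rewrite /room set0I cards0 subn0 /gain mulrC ler_wpM2l//.
by have := miss_le R b_gt0 b_le_T; lra.
Qed.

End Feature.
End Coverage.

Theorem theorem4 (R : realType) (eps : R) (eps_gt0 : 0 < eps) :
  exists T0 : nat, forall T : nat, (T0 <= T)%N ->
    forall (I J K : finType) (N : onccm R I J K T)
           (x : I * J -> R) (z : I * K -> R) (D : J -> {set I * J} -> R),
      lp_optimal N x z ->
      (forall j : J,
         dependent_rounding (worker_edges N j) (fun e => x e / rate N j) (D j)) ->
      forall f : I * K,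
        (580 / 1000 - eps) * Num.min 1 (\sum_(e in feature_edges N f) x e)
          <= expect (alg2_law N D) (fun rounds => (covered N f rounds)%:R).
Proof.
(* The bound 0.58 holds for every [T >= 1]. *)
exists 1%N => T T_gt0 I J K N x z D [feas _] rounding f.
apply: le_trans (covered_ge T_gt0 feas rounding f).
have [_ _ _ _ x_itv _] := feas.
apply: ler_wpM2r; last by lra.
rewrite le_min ler01 sumr_ge0// => e; rewrite !inE => /andP[/andP[eG _] _].
by have /andP[] := x_itv e eG.
Qed.
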